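(* Let $X_1,\ldots,X_k$ ($k\geqslant 2$) be nonempty compact Hausdorff spaces and $G$ a compact Hausdorff topological group. Let $G^{k-1}$ act on $\prod_{i=1}^k(X_i\ast G)$ by \[ (r_1,\ldots,r_{k-1})\cdot(x_1,1-t_1,q_1,t_1;\ \ldots;\ x_k,1-t_k,q_k,t_k)=(x_1,1-t_1,q_1r_1^{-1},t_1;\ x_2,1-t_2,r_1q_2r_2^{-1},t_2;\ \ldots;\ x_k,1-t_k,r_{k-1}q_k,t_k). \] Then the orbit space $\prod_{i=1}^k(X_i\ast G)/G^{k-1}$ is homeomorphic to the join $X_1\ast X_2\ast\cdots\ast X_k\ast G$, and the canonical projection onto the orbit space is given by \[ (x_1,1-t_1,q_1,t_1;\ldots;x_k,1-t_k,q_k,t_k)\mapsto\frac{1}{A}\,(x_1,1-t_1;\ x_2,1-t_2;\ \ldots;\ x_k,1-t_k;\ q_1q_2\cdots q_k,\ t_1t_2\cdots t_k), \] where $A=t_1\cdots t_k+\sum_{i=1}^k(1-t_i)$ and the factor $1/A$ multiplies all the barycentric weights.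
   Context: The join $Y_1\ast\cdots\ast Y_m$ is the quotient of $Y_1\times\cdots\times Y_m\times\Delta^{m-1}$, where $\Delta^{m-1}=\{(s_1,\ldots,s_m):s_i\geqslant0,\ \sum s_i=1\}$, by the equivalence relation generated by $(y_1,\ldots,y_l,\ldots,y_m,s)\sim(y_1,\ldots,y_l',\ldots,y_m,s)$ whenever $s_l=0$. A point of $Y_1\ast\cdots\ast Y_m$ is written $(y_1,s_1;\ldots;y_m,s_m)$. In particular a point of $X_i\ast G$ is written $(x_i,1-t_i,q_i,t_i)$ with $x_i\in X_i$, $q_i\in G$, $t_i\in[0,1]$ (weight $1-t_i$ on $x_i$ and $t_i$ on $q_i$). *)

(* Defs.v *)
From HB Require Import structures.
From mathcomp Require Import all_boot all_order all_algebra.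
From mathcomp Require Import all_classical all_reals.
From mathcomp Require Import topology_structure quotient_topology subtype_topology
  function_spaces product_topology separation_axioms compact.
From mathcomp Require Import Rstruct Rstruct_topology.
From mathcomp Require Import generic_quotient.
Set Implicit Arguments. Unset Strict Implicit. Unset Printing Implicit Defensive.
Import Order.TTheory GRing.Theory Num.Theory.
Local Open Scope classical_set_scope.
Local Open Scope ring_scope.

Notation RR := Rdefinitions.R.

Definition gen_equiv_prop {T : Type} (S : T -> T -> Prop) (a b : T) : Prop :=
  forall E : T -> T -> Prop,
    (forall x, E x x) -> (forall x y, E x y -> E y x) ->
    (forall x y z, E x y -> E y z -> E x z) ->
    (forall x y, S x y -> E x y) -> E a b.

Definition gen_rel {T : Type} (S : T -> T -> Prop) : rel T :=
  fun a b => `[< gen_equiv_prop S a b >].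

Lemma gen_rel_refl T (S : T -> T -> Prop) : reflexive (gen_rel S).
Proof. by move=> x; rewrite /gen_rel; apply/asboolP => E r _ _ _; exact: r. Qed.

Lemma gen_rel_sym1 T (S : T -> T -> Prop) x y :
  gen_equiv_prop S x y -> gen_equiv_prop S y x.
Proof. move=> h E r s t i; apply s; exact: (h E r s t i). Qed.

Lemma gen_rel_sym T (S : T -> T -> Prop) : symmetric (gen_rel S).
Proof.
move=> x y; rewrite /gen_rel; apply/asboolP/asboolP; exact: gen_rel_sym1.
Qed.

Lemma gen_rel_trans T (S : T -> T -> Prop) : transitive (gen_rel S).
Proof.
move=> y x z; rewrite /gen_rel => /asboolP h1 /asboolP h2; apply/asboolP => E r s t i.
by apply (t _ y); [exact: (h1 E r s t i)|exact: (h2 E r s t i)].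
Qed.

Definition gen_equiv {T : Type} (S : T -> T -> Prop) : equiv_rel T :=
  EquivRel (gen_rel S) (@gen_rel_refl T S) (@gen_rel_sym T S) (@gen_rel_trans T S).

Definition quot (T : topologicalType) (S : T -> T -> Prop) : topologicalType :=
  quotient_topology {eq_quot (gen_equiv S)}%qT.

Definition simplex (I : finType) : set (prod_topology (fun _ : I => RR)) :=
  [set s | (forall i, 0 <= s i) /\ \sum_(i in [set: I]%SET) s i = 1].

Definition simplexT (I : finType) : topologicalType := set_type (@simplex I).

Definition join_base (I : finType) (Y : I -> topologicalType) : topologicalType :=
  (prod_topology Y * simplexT I)%type.

Definition join_gen (I : finType) (Y : I -> topologicalType)
  (a b : join_base Y) : Prop :=
  a.2 = b.2 /\ exists l : I, set_val a.2 l = 0 /\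
                       forall i, i != l -> a.1 i = b.1 i.

Definition join (I : finType) (Y : I -> topologicalType) : topologicalType :=
  quot (@join_gen I Y).

(** Family for the binary join X * G: index [false] is X, index [true] is G.
    A point (x, 1-t, q, t) has weight 1-t on [false] and t on [true]. *)
Definition fam2 (X G : topologicalType) : bool -> topologicalType :=
  fun b => if b then G else X.

Definition famk (k : nat) (X : 'I_k -> topologicalType) (G : topologicalType)
  : option 'I_k -> topologicalType :=
  fun o => match o with Some i => X i | None => G end.

Definition prod_joins (k : nat) (X : 'I_k -> topologicalType) (G : topologicalType)
  : topologicalType := prod_topology (fun i : 'I_k => join (fam2 (X i) G)).

(** Left and right multipliers for coordinate i (0-based) under
    r = (r_1, ..., r_{k-1}) : the i-th coordinate q_i becomes
    r_{i-1} q_i r_i^{-1} (1-based, with r_0 = r_k = 1). *)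
Definition lfac (G : Type) (e : G) (m : nat) (r : 'I_m -> G) (i : nat) : G :=
  if i is j.+1 then (if @insub nat (fun n => n < m)%N 'I_m j is Some o then r o else e)
  else e.

Definition rfac (G : Type) (e : G) (inv : G -> G) (m : nat) (r : 'I_m -> G)
  (i : nat) : G :=
  if @insub nat (fun n => n < m)%N 'I_m i is Some o then inv (r o) else e.

Definition act_rel (k : nat) (X : 'I_k -> topologicalType) (G : topologicalType)
  (mul : G -> G -> G) (inv : G -> G) (e : G)
  (p p' : prod_joins X G) : Prop :=
  exists (r : 'I_k.-1 -> G) (a a' : forall i : 'I_k, join_base (fam2 (X i) G)),
    (forall i, (\pi_(join (fam2 (X i) G)) (a i))%qT = p i) /\
    (forall i, (\pi_(join (fam2 (X i) G)) (a' i))%qT = p' i) /\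
    (forall i, (a' i).2 = (a i).2 /\ (a' i).1 false = (a i).1 false /\
       (a' i).1 true = mul (mul (lfac e r i) ((a i).1 true)) (rfac e inv r i)).

Definition orbit_space (k : nat) (X : 'I_k -> topologicalType) (G : topologicalType)
  (mul : G -> G -> G) (inv : G -> G) (e : G) : topologicalType :=
  quot (@act_rel k X G mul inv e).

Definition homeomorphism (A B : topologicalType) (f : A -> B) : Prop :=
  continuous f /\ exists g : B -> A, [/\ continuous g, cancel f g & cancel g f].

(* Main.v *)
(** Write [t_i] for the weight of [q_i] in the [i]-th factor.  The formula of the
    theorem defines a continuous map from the product of the bases of the joins
    [X_i * G] to [X_1 * ... * X_k * G].  Two base points of a join represent the
    same point iff their weights agree and their coordinates agree wherever the
    weight is nonzero; hence a join of Hausdorff spaces is Hausdorff.  A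
    continuous surjection from a compact space to a Hausdorff space is a quotient
    map, so the formula descends continuously to the product of the joins, then
    to the orbit space because [q_1 ... q_k] telescopes under the action.  The
    result is a continuous map from a compact space to a Hausdorff space, and it
    remains to see that it is bijective.

    Surjectivity: weights [(s_1, ..., s_k, s_0)] are attained at [t_i = 1 - c s_i]
    for a root [c] of [prod (1 - c s_i) = c s_0], given by the intermediate value
    theorem; then [A = c].  Injectivity: the weights determine the [t_i].  When
    all [t_i] are nonzero, equality of the products of the [q_i] lets one solve
    successively for the [r_i]; when some [t_j = 0], the coordinate [q_j] is free
    and can be chosen to make the products equal. *)

Require Import Defs.
From HB Require Import structures.
From mathcomp Require Import all_boot all_order all_algebra.
From mathcomp Require Import all_classical all_reals.
From mathcomp Require Import topology_structure quotient_topology subtype_topology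
  function_spaces product_topology separation_axioms compact.
From mathcomp Require Import Rstruct Rstruct_topology.
From mathcomp Require Import generic_quotient.
From mathcomp Require Import initial_topology supremum_topology subspace_topology normedtype lra.
Import Order.TTheory GRing.Theory Num.Theory.
Import numFieldNormedType.Exports.
Local Open Scope classical_set_scope.
Local Open Scope ring_scope.
Set Implicit Arguments. Unset Strict Implicit.

(** * Compact spaces, products and quotients *)

Lemma continuous_prod_topology (T : topologicalType) (I : Type)
    (K : I -> topologicalType) (f : T -> prod_topology K) :
  (forall i, continuous (fun x => f x i)) -> continuous f.
Proof.
move=> fc x; apply/cvg_sup => i U [_ [[B oB <-] Bfx BU]].
apply: filterS BU _; apply: fc; exact: open_nbhs_nbhs.
Qed.

Lemma continuous_prod_topology_proj (I : eqType) (K : I -> topologicalType)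
    (i : I) : continuous (fun f : prod_topology K => f i).
Proof. exact: (@proj_continuous I K i). Qed.

Lemma continuous_pair (T U V : topologicalType) (f : T -> U) (g : T -> V) :
  continuous f -> continuous g -> continuous (fun x => (f x, g x)).
Proof. by move=> fc gc x; apply: cvg_pair; [exact: fc | exact: gc]. Qed.

Lemma continuous_set_type (T U : topologicalType) (A : set U)
    (f : T -> set_type A) :
  continuous (fun x => set_val (f x)) -> continuous f.
Proof.
move=> fc x U' [_ [[B oB <-] Bfx BU]].
apply: filterS BU _; apply: fc; exact: open_nbhs_nbhs.
Qed.

(** The image filter under [set_val] clusters at some point of [A]. Open sets of the subtype are
    traces of open sets of [T], so that point is a cluster point of the original filter. *)
Lemma compact_set_type (T : topologicalType) (A : set T) :
  compact A -> compact [set: set_type A].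
Proof.
move=> cA F PF _.
have [|p [Ap clp]] := cA (set_val @ F) _.
  by rewrite /nbhs /=; apply: filterS filterT => x _; exact: set_valP.
exists (SigSub (mem_set Ap)); split => // B C FB [_ [[W oW <-] Wp WC]].
have [||_ [[y By <-] Wy]] := clp (set_val @` B) W.
- by apply: (@filterS _ F _ B) FB => y By; exists y.
- by apply: open_nbhs_nbhs; split.
- by exists y; split=> //; exact: WC.
Qed.

Lemma compact_image_setT (K B : topologicalType) (q : K -> B) :
  compact [set: K] -> continuous q -> (forall y, exists x, q x = y) ->
  compact [set: B].
Proof.
move=> cK qc qs; suff <- : q @` setT = setT.
  by apply: continuous_compact => //; exact: continuous_subspaceT.
by apply/seteqP; split=> // y _; have [x <-] := qs y; exists x.
Qed.

Lemma compact_hausdorff_factor_continuous (K B C : topologicalType)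
    (q : K -> B) (g : K -> C) (phi : B -> C) :
  compact [set: K] -> hausdorff_space B -> continuous q ->
  (forall y, exists x, q x = y) -> continuous g ->
  (forall x, phi (q x) = g x) -> continuous phi.
Proof.
move=> cK hB qc qs gc phiq; apply/continuous_closedP => D cD.
have -> : phi @^-1` D = q @` (g @^-1` D).
  apply/seteqP; split=> [y|_ [x Dx <-]]; last by rewrite /preimage /= phiq.
  by have [x <-] := qs y; rewrite /preimage /= phiq => Dx; exists x.
apply: compact_closed => //; apply: continuous_compact.
  exact: continuous_subspaceT.
apply: subclosed_compact cK _ => //.
by move/continuous_closedP : gc; exact.
Qed.

Lemma bijective_homeomorphism (A B : topologicalType) (f : A -> B) :
  compact [set: A] -> hausdorff_space B -> continuous f -> injective f ->
  (forall y, exists x, f x = y) -> homeomorphism f.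
Proof.
move=> cA hB fc fi fs; split=> //.
have [g gK] := choice fs; have fK : cancel f g by move=> x; apply: fi.
exists g; split=> //.
(* The inverse [g] is the factorization of the identity of [A] through [f]. *)
by apply: (@compact_hausdorff_factor_continuous _ _ _ f id) => // x.
Qed.

Lemma compact_prod_topology (I : eqType) (K : I -> topologicalType) :
  (forall i, compact [set: K i]) -> compact [set: prod_topology K].
Proof.
move=> cK; have := @tychonoff I K (fun=> setT) cK.
by congr compact; apply/seteqP; split.
Qed.

(** * Quotients by a generated equivalence *)

Section Quot.
Variables (T : topologicalType) (S : T -> T -> Prop).

Definition quot_pi : T -> quot S := (\pi_(quot S))%qT.

Lemma quot_pi_continuous : continuous quot_pi.
Proof. exact: pi_continuous. Qed.

Lemma quot_pi_surj (y : quot S) : exists x, quot_pi x = y.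
Proof. by exists (repr y)%qT; exact: reprK. Qed.

Lemma quot_piP (a b : T) : quot_pi a = quot_pi b <-> gen_equiv_prop S a b.
Proof.
split=> [/eqquotP/asboolP //|ab]; exact/eqquotP/asboolP.
Qed.

Lemma quot_open (U : set (quot S)) : open (quot_pi @^-1` U) -> open U.
Proof. by []. Qed.

Lemma quot_pi_sound (a b : T) : S a b -> quot_pi a = quot_pi b.
Proof. by move=> Sab; apply/quot_piP => E _ _ _; apply. Qed.

End Quot.

(** * Joins *)

Section Join.
Variables (I : finType) (Y : I -> topologicalType).
Implicit Types a b : join_base Y.

Definition weight a (l : I) : RR := set_val a.2 l.

(** Explicit form of the equivalence relation generated by [join_gen]. *)
Definition join_equiv a b : Prop :=
  a.2 = b.2 /\ forall l, weight a l != 0 -> a.1 l = b.1 l.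

Lemma weight_ge0 a l : 0 <= weight a l.
Proof. by have [+ _] := set_valP a.2; apply. Qed.

Lemma weight_sum1 a : \sum_l weight a l = 1.
Proof.
have [_ <-] := set_valP a.2; apply: eq_bigl => l; by rewrite finset.in_setT.
Qed.

Lemma weight_le1 a l : weight a l <= 1.
Proof.
rewrite -(weight_sum1 a) (bigD1 l) //= lerDl.
by apply: sumr_ge0 => i _; exact: weight_ge0.
Qed.

Lemma weight_continuous l : continuous (weight^~ l).
Proof.
move=> a; apply: (@continuous_comp _ _ _ (fun a : join_base Y => set_val a.2)
    (fun s : prod_topology (fun _ : I => RR) => s l)).
  apply: (@continuous_comp _ _ _ snd (@set_val _ (@simplex I))).
    exact: cvg_snd.
  exact: initial_continuous.
exact: continuous_prod_topology_proj.
Qed.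

Lemma coord_continuous l : continuous (fun a : join_base Y => a.1 l).
Proof.
move=> a; apply: (@continuous_comp _ _ _ fst
    (fun s : prod_topology Y => s l)); first exact: cvg_fst.
exact: continuous_prod_topology_proj.
Qed.

Lemma join_base_weight_inj a b : weight a = weight b -> a.2 = b.2.
Proof. by move=> ab; apply: val_inj; exact: ab. Qed.

(** [join_equiv] is an equivalence relation containing the generators. Conversely, since [I] is
    finite, finitely many generators lead from [a] to [b]. *)
Lemma join_piP a b :
  quot_pi (@join_gen I Y) a = quot_pi (@join_gen I Y) b <-> join_equiv a b.
Proof.
split=> [/quot_piP/(_ join_equiv)|].
  rewrite /join_equiv; apply.
  - by [].
  - move=> x y [xy2 xy1]; split=> // l; rewrite /weight -xy2 => /xy1 //.
  - move=> x y z [xy2 xy1] [yz2 yz1]; split=> [|l wl]; first by rewrite xy2.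
    by rewrite xy1// yz1// /weight -xy2.
  - move=> x y [xy2 [l [wl xy1]]]; split=> // j wj; apply: xy1.
    by apply: contraNneq wj => ->; exact/eqP.
case: a => a s; case: b => b s' [/= <- ab].
(* swap the coordinates of zero weight one at a time *)
pose c (r : seq I) : prod_topology Y := fun i => if i \in r then b i else a i.
have step r : quot_pi (@join_gen I Y) (a, s) = quot_pi (@join_gen I Y) (c r, s).
  elim: r => [|l r ->]; first by congr (quot_pi _ (_, _)); exact/functional_extensionality_dep.
  have [w0|wN0] := eqVneq (set_val s l) 0.
    apply: quot_pi_sound; split=> //; exists l; split=> // i il.
    by rewrite /c /= in_cons (negbTE il).
  congr (quot_pi _ (_, _)); apply: functional_extensionality_dep => i.
  rewrite /c in_cons; case: eqVneq => //= ->; rewrite ab //.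
  by case: ifP.
rewrite (step (enum I)); congr (quot_pi _ (_, _)).
by apply: functional_extensionality_dep => i; rewrite /c mem_enum.
Qed.

(** Points with different weights are separated by a weight. Otherwise they differ in a coordinate
    of positive weight, and disjoint neighbourhoods of its two values, taken where that weight is
    positive, are saturated. *)
Lemma join_hausdorff : (forall i, hausdorff_space (Y i)) ->
  hausdorff_space (join Y).
Proof.
move=> hY; rewrite open_hausdorff => p q.
have [a <-] := quot_pi_surj p; have [b <-] := quot_pi_surj q => abN.
(* it suffices to separate by saturated open sets of the base *)
suff [U [V [oU oV Ua Vb [Usat Vsat UV]]]] : exists (U V : set (join_base Y)),
    [/\ open U, open V, U a, V b &
     [/\ forall x y, join_equiv x y -> U x -> U y,
         forall x y, join_equiv x y -> V x -> V y & U `&` V = set0]].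
  (* A saturated set is the preimage of its image, so the image of a saturated open set is open in
     the quotient. *)
  have sat (W : set (join_base Y)) : (forall x y, join_equiv x y -> W x -> W y) ->
      quot_pi (@join_gen I Y) @^-1` (quot_pi (@join_gen I Y) @` W) = W.
    move=> Wsat; apply/seteqP; split=> [x [y Wy /join_piP xy]|x Wx].
      exact: Wsat Wy.
    by exists x.
  exists (quot_pi (@join_gen I Y) @` U, quot_pi (@join_gen I Y) @` V).
    by split; rewrite inE /=; [exists a | exists b].
  split; [by apply: quot_open; rewrite sat|by apply: quot_open; rewrite sat|].
  apply/eqP/seteqP; split=> // _ [[x Ux <-] [y Vy /join_piP yx]].
  suff : (U `&` V) x by rewrite UV.
  by split=> //; exact: Vsat yx Vy.
have [ab|] := eqVneq (weight a) (weight b); last first.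
  move=> wN; have [l /eqP wl] : exists l, weight a l <> weight b l.
    by apply/existsNP => h; move/eqP: wN; apply; apply/funext.
  have := @Rhausdorff RR; rewrite open_hausdorff => /(_ _ _ wl)[[A B] /= [/set_mem Aa /set_mem Bb] [oA oB /eqP AB]].
  exists (weight^~ l @^-1` A), (weight^~ l @^-1` B); split=> //.
  - by move/continuousP : (@weight_continuous l); apply.
  - by move/continuousP : (@weight_continuous l); apply.
  - split.
    + by move=> x y [xy _]; rewrite /preimage /= /weight xy.
    + by move=> x y [xy _]; rewrite /preimage /= /weight xy.
    + by rewrite -preimage_setI AB preimage_set0.
have [l /not_implyP [wl /eqP abl]] :
    exists l, ~ (weight a l != 0 -> a.1 l = b.1 l).
  apply/existsNP => h; move/eqP: abN; apply; apply/join_piP; split=> //.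
  exact: join_base_weight_inj.
have := hY l; rewrite open_hausdorff => /(_ _ _ abl)[[A B] /= [/set_mem Aa /set_mem Bb] [oA oB /eqP AB]].
pose P (C : set (Y l)) : set (join_base Y) :=
  (weight^~ l @^-1` [set r | 0 < r]) `&` ((fun a : join_base Y => a.1 l) @^-1` C).
have oP C : open C -> open (P C).
  move=> oC; apply: openI.
    by move/continuousP : (@weight_continuous l); apply; exact: open_gt.
  by move/continuousP : (@coord_continuous l); apply.
have Psat C x y : join_equiv x y -> P C x -> P C y.
  move=> [xy2 xy1] [wx Cx]; split; first by move: wx; rewrite /preimage /= /weight xy2.
  rewrite /preimage /= -xy1 //; exact: lt0r_neq0.
exists (P A), (P B); split; [exact: oP|exact: oP| | |].
- by split => //; rewrite /preimage /= lt0r wl weight_ge0.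
- by split => //; rewrite /preimage /= -ab lt0r wl weight_ge0.
- split; [exact: Psat|exact: Psat|].
  apply/seteqP; split=> // x [[_ Ax] [_ Bx]].
  suff : set0 (x.1 l) by [].
  by rewrite -AB.
Qed.

(** The simplex is closed in the cube [[0, 1]^I], which is compact by Tychonoff. *)
Lemma simplex_compact : compact (@simplex I).
Proof.
have cI := @tychonoff I (fun=> RR) (fun=> [set` `[0, 1]])
  (fun=> @segment_compact RR 0 1).
apply: subclosed_compact cI _; last first.
  move=> s [s0 s1] i /=; rewrite in_itv /= s0 /= -s1 (bigD1 i) ?finset.in_setT //=.
  by rewrite lerDl sumr_ge0.
rewrite (_ : @simplex I = (\bigcap_i [set s | 0 <= s i]) `&`
    [set s | \sum_(i in [set: I]%SET) s i = 1]); last first.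
  apply/seteqP; split=> s [s0 s1]; split=> // i; last exact: s0.
  by move=> _; exact: s0.
apply: closedI.
  apply: closed_bigI => i _.
  have /continuous_closedP :=
    @continuous_prod_topology_proj _ (fun _ : I => RR) i.
  by move=> /(_ _ (@closed_ge RR 0)).
have /continuous_closedP : continuous (fun s : prod_topology (fun _ : I => RR) =>
    \sum_(i in [set: I]%SET) s i).
  apply: (continuous_big (@add_continuous RR^o)) => i _.
  exact: continuous_prod_topology_proj.
by move=> /(_ _ (@closed_eq RR 1)).
Qed.

Lemma join_base_compact : (forall i, compact [set: Y i]) ->
  compact [set: join_base Y].
Proof.
move=> cY; rewrite -setXTT; apply: compact_setX.
  exact: compact_prod_topology.
exact/compact_set_type/simplex_compact.
Qed.

End Join.

(** * The action on products of group elements *)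

Section GroupProducts.
Variables (G : Type) (mul : G -> G -> G) (inv : G -> G) (e : G).
Hypothesis mulA : forall x y z, mul x (mul y z) = mul (mul x y) z.
Hypothesis mul1g : forall x, mul e x = x.
Hypothesis mulVg : forall x, mul (inv x) x = e.

Lemma mulgV_of_left x : mul x (inv x) = e.
Proof.
rewrite -[mul x _]mul1g -{1}(mulVg (inv x)) -mulA (mulA (inv x)) mulVg mul1g.
exact: mulVg.
Qed.

Lemma mulg1_of_left x : mul x e = x.
Proof. by rewrite -(mulVg x) mulA mulgV_of_left mul1g. Qed.

Lemma invg1_of_left : inv e = e.
Proof. by rewrite -[inv e]mulg1_of_left mulVg. Qed.

(** In a group, a product can be given any value by changing one chosen factor. This serves for a
    group coordinate of zero weight, and for building preimages. *)
Lemma big_mul_adjust (I : eqType) (s : seq I) (q : I -> G) (j : I) (g : G) :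
  uniq s -> j \in s ->
  exists v, \big[mul/e]_(i <- s) (if i == j then v else q i) = g.
Proof.
elim: s g => // i s IH g /= /andP[iNs us]; rewrite in_cons => /predU1P[ji|js].
  subst j; exists (mul g (inv (\big[mul/e]_(i <- s) q i))).
  rewrite big_cons eqxx [X in mul _ X](_ : _ = \big[mul/e]_(i <- s) q i).
    by rewrite -mulA mulVg mulg1_of_left.
  by apply: eq_big_seq => l ls; case: eqVneq => // li; rewrite -li ls in iNs.
have [v hv] := IH (mul (inv (q i)) g) us js; exists v.
rewrite big_cons hv ifN; first by rewrite mulA mulgV_of_left mul1g.
by apply: contraNneq iNs => ->.
Qed.

(** Consecutive factors cancel at every index, including out of range, where both sides are [e].
    This is what makes the product telescope. *)
Lemma rfac_lfac (m : nat) (r : 'I_m -> G) (i : nat) :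
  rfac e inv r i = inv (lfac e r i.+1).
Proof. by rewrite /rfac /=; case: insub => //; rewrite invg1_of_left. Qed.

Lemma lfac_last (k : nat) (r : 'I_k.-1 -> G) : lfac e r k = e.
Proof. by case: k r => //= k r; rewrite insubN // ltnn. Qed.

Section Suffix.
Variables (k : nat) (q : 'I_k -> G).

(** Indexing by [nat] allows the empty product at [n = k]; the default [e] is never reached, since
    [j < k]. *)
Definition suffix_prod (n : nat) : G :=
  \big[mul/e]_(n <= j < k) (if insub j is Some i then q i else e).

Lemma suffix_prod0 : suffix_prod 0 = \big[mul/e]_(i < k) q i.
Proof.
by rewrite /suffix_prod big_mkord; apply: eq_bigr => i _; rewrite valK.
Qed.

Lemma suffix_prod_last : suffix_prod k = e.
Proof. by rewrite /suffix_prod big_geq. Qed.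

Lemma suffix_prodS (i : 'I_k) : suffix_prod i = mul (q i) (suffix_prod i.+1).
Proof. by rewrite /suffix_prod big_ltn // valK. Qed.

End Suffix.

(** Downward induction on [n = k - m]: the product of [q'] from [n] on is [lfac e r n] times that of
    [q], and the left factor at [0] is [e]. *)
Lemma act_big_mul (k : nat) (q q' : 'I_k -> G) (r : 'I_k.-1 -> G) :
  (forall i : 'I_k, q' i = mul (mul (lfac e r i) (q i)) (rfac e inv r i)) ->
  \big[mul/e]_(i < k) q' i = \big[mul/e]_(i < k) q i.
Proof.
move=> q'E; rewrite -!suffix_prod0.
suff H m : (m <= k)%N ->
    suffix_prod q' (k - m) = mul (lfac e r (k - m)) (suffix_prod q (k - m)).
  by have := H k (leqnn k); rewrite subnn mul1g.
elim: m => [_|m IH mk].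
  by rewrite subn0 !suffix_prod_last lfac_last mul1g.
have lt : (k - m.+1 < k)%N by rewrite -subn_gt0 subKn.
have kE : (Ordinal lt).+1 = (k - m)%N by rewrite /= -(subSn mk) subSS.
have := suffix_prodS q (Ordinal lt); have := suffix_prodS q' (Ordinal lt).
have := q'E (Ordinal lt); rewrite rfac_lfac kE => -> -> ->.
rewrite (IH (ltnW mk)).
by rewrite -!mulA; congr mul; congr mul; rewrite mulA mulVg mul1g.
Qed.

(* [r_i] is the quotient of the products of [q'] and of [q] over the indices greater than [i]. *)
Lemma act_of_big_mul (k : nat) (q q' : 'I_k -> G) :
  \big[mul/e]_(i < k) q' i = \big[mul/e]_(i < k) q i ->
  exists r : 'I_k.-1 -> G,
    forall i : 'I_k, q' i = mul (mul (lfac e r i) (q i)) (rfac e inv r i).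
Proof.
move=> qq'; pose d n := mul (suffix_prod q' n) (inv (suffix_prod q n)).
exists (fun o => d o.+1).
(* The boundary convention [r_0 = r_k = 1] holds for [d]: at [0] because the full products agree, at
   [k] because both suffixes are empty. *)
have lfacE n : (n <= k)%N -> lfac e (fun o : 'I_k.-1 => d o.+1) n = d n.
  case: n => [_|n nk] /=; first by rewrite /d !suffix_prod0 qq' mulgV_of_left.
  case: insubP => [o _ <- //|]; rewrite -leqNgt => kn.
  have -> : n.+1 = k by apply/eqP; rewrite eqn_leq nk; case: (k) kn.
  by rewrite /d !suffix_prod_last mulgV_of_left.
move=> i; rewrite rfac_lfac !lfacE ?(ltnW (ltn_ord i)) // /d suffix_prodS.
have inv_uniq x y : mul x y = e -> inv x = y.
  by move=> xy; rewrite -[inv x]mulg1_of_left -xy mulA mulVg mul1g.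
have invM x y : inv (mul x y) = mul (inv y) (inv x).
  by apply: inv_uniq; rewrite -mulA (mulA y) mulgV_of_left mul1g mulgV_of_left.
(* With both suffix products expanded at [i], everything cancels except [q' i]. *)
rewrite (suffix_prodS q i) !invM -!mulA (mulA (inv (q i))) mulVg mul1g.
rewrite (inv_uniq (inv _) _ (mulVg _)) (mulA (inv _)) mulVg mul1g.
by rewrite mulgV_of_left mulg1_of_left.
Qed.

End GroupProducts.

(** * The barycentric weights *)

Section Weights.
Variables (R : realFieldType) (I : finType).
Implicit Types t : I -> R.

(** The normalizing factor [A] of the theorem. *)
Definition total_weight t : R := \prod_i t i + \sum_i (1 - t i).

Definition join_weight t (o : option I) : R :=
  (if o is Some i then 1 - t i else \prod_i t i) / total_weight t.

(** If every [t i] is [1] the product is [1]; otherwise some [1 - t i] is positive. *)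
Lemma total_weight_gt0 t :
  (forall i, 0 <= t i <= 1) -> 0 < total_weight t.
Proof.
move=> t01; have s0 : 0 <= \sum_i (1 - t i).
  by apply: sumr_ge0 => i _; rewrite subr_ge0; case/andP: (t01 i).
have [/forallP h|/forallPn[i ti]] := boolP [forall i, t i == 1].
  rewrite ltr_pwDl // big1 ?ltr01 // => i _; exact/eqP.
rewrite ltr_wpDl //.
  by apply: prodr_ge0 => j _; case/andP: (t01 j).
rewrite (bigD1 i) //= ltr_pwDl //.
  by rewrite subr_gt0 lt_neqAle ti; case/andP: (t01 i).
by apply: sumr_ge0 => j _; rewrite subr_ge0; case/andP: (t01 j).
Qed.

Lemma join_weight_ge0 t o : (forall i, 0 <= t i <= 1) -> 0 <= join_weight t o.
Proof.
move=> t01; apply: divr_ge0; last exact/ltW/total_weight_gt0.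
case: o => [i|]; first by rewrite subr_ge0; case/andP: (t01 i).
by apply: prodr_ge0 => j _; case/andP: (t01 j).
Qed.

Lemma sum_option (f : option I -> R) :
  \sum_o f o = f None + \sum_i f (Some i).
Proof.
rewrite (bigD1 None) //=; congr (_ + _).
rewrite (reindex_omap Some id) //=; last by case.
by apply: eq_bigl => i; rewrite eqxx.
Qed.

Lemma join_weight_sum1 t :
  (forall i, 0 <= t i <= 1) -> \sum_o join_weight t o = 1.
Proof.
move=> t01; rewrite sum_option /= -mulr_suml -mulrDl divff //.
exact/lt0r_neq0/total_weight_gt0.
Qed.

(* If [A t < A t'], then [1 - t = c (1 - t')] and [prod t = c prod t'] with
   [c < 1], so [t' <= t] and [prod t' <= prod t = c prod t']; hence both products
   vanish, and some [t i = 0] gives [1 = c (1 - t' i) < 1]. *)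
Lemma join_weight_le t t' : (forall i, 0 <= t i <= 1) ->
  (forall i, 0 <= t' i <= 1) -> join_weight t = join_weight t' ->
  total_weight t' <= total_weight t.
Proof.
move=> t01 t'01 tt'; rewrite leNgt; apply/negP => AA'.
have A0 := total_weight_gt0 t01; have A'0 := total_weight_gt0 t'01.
set c := total_weight t / total_weight t'.
have c1 : c < 1 by rewrite ltr_pdivrMr // mul1r.
have scale o (x x' : R) : x / total_weight t = x' / total_weight t' -> x = c * x'.
  move=> h; rewrite /c mulrAC -mulrA -h mulrC divfK //; exact: lt0r_neq0.
have tS i : 1 - t i = c * (1 - t' i).
  by apply: scale => //; have := congr1 (@^~ (Some i)) tt'.
have pS : \prod_i t i = c * \prod_i t' i.
  by apply: scale => //; have := congr1 (@^~ None) tt'.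
have c0 : 0 < c by rewrite divr_gt0.
have t't i : t' i <= t i by have := tS i; have := t'01 i; nra.
have pp : \prod_i t' i <= \prod_i t i.
  by apply: ler_prod => i _; rewrite t't; case/andP: (t'01 i) => ->.
have [p0|p0] := eqVneq (\prod_i t' i) 0; last first.
  have : 0 < \prod_i t' i.
    by rewrite lt0r p0; apply: prodr_ge0 => i _; case/andP: (t'01 i).
  nra.
move: pS; rewrite p0 mulr0 => /eqP/prodf_eq0[i _ /eqP ti].
by have := tS i; have := t'01 i; rewrite ti; nra.
Qed.

(** The inequality applied in both directions gives equal normalizing factors, which then cancel. *)
Lemma join_weight_inj t t' : (forall i, 0 <= t i <= 1) ->
  (forall i, 0 <= t' i <= 1) -> join_weight t = join_weight t' -> t =1 t'.
Proof.
move=> t01 t'01 tt' i.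
have AA' : total_weight t = total_weight t'.
  by apply/le_anti; rewrite !join_weight_le.
have A0 := lt0r_neq0 (total_weight_gt0 t'01).
have := congr1 (@^~ (Some i)) tt'; rewrite /join_weight AA'.
by move=> /(mulIf (invr_neq0 A0)) /addrI /oppr_inj.
Qed.

End Weights.

(** * Surjectivity and continuity of the weights *)

Section WeightsContinuous.
Variables (R : realType) (I : finType).

Lemma continuous_subr (T : topologicalType) (f g : T -> R) :
  continuous f -> continuous g -> continuous (fun x => f x - g x).
Proof. by move=> fc gc x; exact: (@continuousB R R^o T f g x (fc x) (gc x)). Qed.

Lemma continuous_mulr (T : topologicalType) (f g : T -> R) :
  continuous f -> continuous g -> continuous (fun x => f x * g x).
Proof. by move=> fc gc x; exact: (@continuousM R T f g x (fc x) (gc x)). Qed.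

Lemma continuous_addr (T : topologicalType) (f g : T -> R) :
  continuous f -> continuous g -> continuous (fun x => f x + g x).
Proof. by move=> fc gc x; exact: (@continuousD R R^o T f g x (fc x) (gc x)). Qed.

Lemma join_weight_surj (s : option I -> R) (i0 : I) :
  (forall o, 0 <= s o) -> \sum_o s o = 1 ->
  exists t : I -> R, (forall i, 0 <= t i <= 1) /\ join_weight t = s.
Proof.
move=> s0 s1.
suff [c [c0 cs cE]] : exists c, [/\ 0 <= c, forall i, c * s (Some i) <= 1 &
    \prod_i (1 - c * s (Some i)) = c * s None].
  have tot : total_weight (fun i => 1 - c * s (Some i)) = c.
    rewrite /total_weight cE (eq_bigr (fun i => c * s (Some i))).
      by rewrite -mulr_sumr -mulrDr -sum_option s1 mulr1.
    by move=> i _; rewrite opprB addrC subrK.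
  have t01 i : 0 <= 1 - c * s (Some i) <= 1.
    by rewrite subr_ge0 cs lerBlDr lerDl mulr_ge0.
  exists (fun i => 1 - c * s (Some i)); split=> //.
  have cN0 : c != 0 by have := lt0r_neq0 (total_weight_gt0 t01); rewrite tot.
  apply/funext => o; rewrite /join_weight tot; case: o => [i|].
    by rewrite opprB addrC subrK mulrC mulKf.
  by rewrite cE mulrC mulKf.
(* For [c] up to [1 / M] all [c * s (Some i)] stay at most [1], and at [c = 1 / M] a factor of the
   product vanishes. The index [i0] seeds the maximum. *)
pose M := s (Some [arg max_(i > i0) s (Some i)]%O).
have sM i : s (Some i) <= M.
  by rewrite /M; case: Order.TotalTheory.arg_maxP => // j _; apply.
(* If [M = 0], the whole weight is on [None], and [c = 1] works. *)
have [M0|M0] := eqVneq M 0.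
  have sS i : s (Some i) = 0 by apply/le_anti; rewrite s0 -M0 sM.
  exists 1; split=> // [i|]; first by rewrite sS mulr0.
  rewrite big1 => [|i _]; last by rewrite sS mulr0 subr0.
  by rewrite mul1r -s1 sum_option big1 ?addr0.
have {}M0 : 0 < M by rewrite lt0r M0 s0.
pose g (c : R) := c * s None - \prod_i (1 - c * s (Some i)).
have gc : continuous g.
  have sc o : continuous (fun c : R => c * s o).
    by apply: continuous_mulr; [move=> x; exact: cvg_id|exact: cst_continuous].
  apply: continuous_subr => //.
  apply: (continuous_big (@mul_continuous R)) => i _.
  by apply: continuous_subr => //; exact: cst_continuous.
(* [g] runs from [-1] at [0] to a nonnegative value at [1 / M]. *)
have [|||c] := @IVT R g 0 M^-1 0.
- by rewrite invr_ge0 ltW.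
- exact: continuous_subspaceT.
- have -> : g 0 = -1.
    by rewrite /g mul0r big1 ?sub0r // => i _; rewrite mul0r subr0.
  have gM : 0 <= g M^-1.
    rewrite /g (bigD1 [arg max_(i > i0) s (Some i)]%O) //= -/M mulVf ?gt_eqF //.
    by rewrite subrr mul0r subr0 mulr_ge0 // invr_ge0 ltW.
  by rewrite ge_min le_max gM lerN10 orbT.
rewrite in_itv /= => /andP[c0 cM] /eqP; rewrite subr_eq0 => /eqP gc0.
exists c; split=> // i; rewrite -(mulVf (lt0r_neq0 M0)).
by apply: ler_pM.
Qed.

Lemma join_weight_continuous (T : topologicalType) (t : T -> I -> R) o :
  (forall x i, 0 <= t x i <= 1) -> (forall i, continuous (t^~ i)) ->
  continuous (fun x => join_weight (t x) o).
Proof.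
move=> t01 tc; have pc : continuous (fun x => \prod_i t x i).
  by apply: (continuous_big (@mul_continuous R)) => i _; exact: tc.
have sc i : continuous (fun x => 1 - t x i).
  by apply: continuous_subr => //; exact: cst_continuous.
apply: continuous_mulr; first by case: o => [i|]; [exact: sc|exact: pc].
move=> x; apply: (@cvgV R _ _ _ (fun x => total_weight (t x)));
  first exact/lt0r_neq0/total_weight_gt0.
move: x; apply: continuous_addr => //.
by apply: (continuous_big (@add_continuous R^o)) => i _; exact: sc.
Qed.

End WeightsContinuous.

(** * The map on the orbit space *)

Section BinaryJoin.
Variables X G : topologicalType.
Implicit Type a : join_base (fam2 X G).

Lemma weight_false a : weight a false = 1 - weight a true.
Proof. by rewrite -(weight_sum1 a) big_bool /= addrC addrK. Qed.

Lemma weight_true_itv a : 0 <= weight a true <= 1.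
Proof. by rewrite weight_ge0 weight_le1. Qed.

Definition fam2_pair (x : X) (g : G) : prod_topology (fam2 X G) :=
  fun b => match b return fam2 X G b with true => g | false => x end.

Lemma simplex_bool (t : RR) : 0 <= t <= 1 ->
  (@simplex bool) (fun b => if b then t else 1 - t).
Proof.
move=> /andP[t0 t1]; split=> [[]|] //; first by rewrite subr_ge0.
under eq_bigl do rewrite finset.in_setT.
by rewrite big_bool /= addrC subrK.
Qed.

End BinaryJoin.

Section OrbitSpace.
Variables (k : nat) (X : 'I_k -> topologicalType) (G : topologicalType).
Variables (mul : G -> G -> G) (inv : G -> G) (e : G).
Hypothesis mulA : forall x y z, mul x (mul y z) = mul (mul x y) z.
Hypothesis mul1g : forall x, mul e x = x.
Hypothesis mulVg : forall x, mul (inv x) x = e.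
Hypothesis mul_cont : continuous (fun p : G * G => mul p.1 p.2).

Local Notation bases := (prod_topology (fun i => join_base (fam2 (X i) G))).
Local Notation pi2 i := (quot_pi (@join_gen bool (fam2 (X i) G))).
Local Notation pik := (quot_pi (@join_gen (option 'I_k) (famk X G))).
Local Notation pio := (quot_pi (@act_rel k X G mul inv e)).
Implicit Types a : bases.

Definition prod_pi a : prod_joins X G := fun i => pi2 i (a i).

Lemma prod_pi_continuous : continuous prod_pi.
Proof.
apply: continuous_prod_topology => i a.
apply: (@continuous_comp _ _ _ (fun a : bases => a i) (pi2 i)).
  exact: continuous_prod_topology_proj.
exact: quot_pi_continuous.
Qed.

Lemma prod_pi_surj (p : prod_joins X G) : exists a, prod_pi a = p.
Proof.
by exists (fun i => repr (p i))%qT; apply: functional_extensionality_dep => i;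
  exact: reprK.
Qed.

Definition qweights a : 'I_k -> RR := fun i => weight (a i) true.

Lemma qweights_itv a i : 0 <= qweights a i <= 1.
Proof. exact: weight_true_itv. Qed.

Lemma simplex_join_weight a : @simplex (option 'I_k) (join_weight (qweights a)).
Proof.
split=> [o|]; first by apply: join_weight_ge0 => i; exact: qweights_itv.
under eq_bigl do rewrite finset.in_setT.
by apply: join_weight_sum1 => i; exact: qweights_itv.
Qed.

Definition join_map a : join_base (famk X G) :=
  (((fun o => match o return famk X G o with
    | Some i => (a i).1 false
    | None => \big[mul/e]_(i < k) (a i).1 true
    end) : prod_topology (famk X G)),
   (SigSub (mem_set (simplex_join_weight a)) : simplexT (option 'I_k))).

Lemma weight_join_map a : weight (join_map a) = join_weight (qweights a).
Proof. by []. Qed.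

Lemma base_proj_continuous i : continuous (fun a : bases => a i).
Proof. exact: continuous_prod_topology_proj. Qed.

Lemma join_map_continuous : continuous join_map.
Proof.
have cc i b : continuous (fun a : bases => (a i).1 b).
  move=> a; apply: (@continuous_comp _ _ _ (fun a : bases => a i)
    (fun x : join_base (fam2 (X i) G) => x.1 b)).
    exact: base_proj_continuous.
  exact: coord_continuous.
apply: continuous_pair.
  apply: continuous_prod_topology => -[i|]; first exact: (cc i false).
  by apply: (continuous_big mul_cont) => i _; exact: (cc i true).
apply: continuous_set_type; apply: continuous_prod_topology => o.
apply: (@join_weight_continuous RR 'I_k bases qweights) => [|i a].
  exact: qweights_itv.
apply: (@continuous_comp _ _ _ (fun a : bases => a i)
    (fun x : join_base (fam2 (X i) G) => weight x true)).
  exact: base_proj_continuous.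
exact: weight_continuous.
Qed.

(** The group coordinate matters only where the product of the [t_i] is nonzero; then every [t_i] is
    nonzero, so every [q_i] is determined. *)
Lemma join_map_equiv a a' :
  (forall i, join_equiv (a i) (a' i)) -> join_equiv (join_map a) (join_map a').
Proof.
move=> aa'; have tt' : qweights a = qweights a'.
  by apply/funext => i; rewrite /qweights /weight (aa' i).1.
split.
  by apply: join_base_weight_inj; rewrite !weight_join_map tt'.
rewrite weight_join_map => -[i|]; rewrite mulf_eq0 negb_or => /andP[w _] /=.
  by have [_ /(_ false)] := aa' i; rewrite weight_false; exact.
apply: eq_bigr => i _; have [_ /(_ true)] := aa' i; apply.
by move/prodf_neq0 : w => /(_ i isT).
Qed.

(** Defined on chosen representatives; [join_map_equiv] makes the choice irrelevant. *)
Definition join_map_quot (p : prod_joins X G) : join (famk X G) :=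
  pik (join_map (fun i => repr (p i))%qT).

Lemma join_map_quotE a : join_map_quot (prod_pi a) = pik (join_map a).
Proof.
apply/join_piP/join_map_equiv => i; apply/join_piP.
exact: reprK.
Qed.

Lemma join_map_quot_act p p' :
  act_rel mul inv e p p' -> join_map_quot p = join_map_quot p'.
Proof.
move=> [r [a [a' [pa [pa' h]]]]].
have <- : prod_pi a = p by apply: functional_extensionality_dep.
have <- : prod_pi a' = p' by apply: functional_extensionality_dep.
rewrite !join_map_quotE; apply/join_piP.
have tt' : qweights a = qweights a'.
  by apply/funext => i; rewrite /qweights /weight (h i).1.
split=> [|o _].
  by apply: join_base_weight_inj; rewrite !weight_join_map tt'.
case: o => [i|] /=; first by have [_ [->]] := h i.
apply/esym; apply: (act_big_mul mulA mul1g mulVg (r := r)) => i.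
by have [_ [_ ->]] := h i.
Qed.

Definition orbit_map (z : orbit_space X mul inv e) : join (famk X G) :=
  join_map_quot (repr z)%qT.

(** Having the same image is an equivalence relation containing [act_rel], so it contains the
    generated one. *)
Lemma orbit_mapE p : orbit_map (pio p) = join_map_quot p.
Proof.
have /quot_piP : pio (repr (pio p))%qT = pio p by exact: reprK.
move/(_ (fun x y => join_map_quot x = join_map_quot y)); apply => //.
- by move=> x y z -> ->.
- by move=> x y; exact: join_map_quot_act.
Qed.

Lemma orbit_map_inj : injective orbit_map.
Proof.
move=> z z'; have [p <-] := quot_pi_surj z; have [p' <-] := quot_pi_surj z'.
rewrite !orbit_mapE; have [a <-] := prod_pi_surj p.
have [a' <-] := prod_pi_surj p'.
rewrite !join_map_quotE => /join_piP[ww' cc'].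
have tt' : qweights a =1 qweights a'.
  apply: join_weight_inj; [exact: qweights_itv|exact: qweights_itv|].
  by rewrite -!weight_join_map /weight ww'.
have AN0 : (total_weight (qweights a))^-1 != 0.
  by rewrite invr_neq0 // lt0r_neq0 // total_weight_gt0 // => i; exact: qweights_itv.
have xx' i : weight (a i) false != 0 -> (a i).1 false = (a' i).1 false.
  move=> w; have /= := cc' (Some i); apply.
  by rewrite weight_join_map mulf_neq0 //= -weight_false.
(* Replace the [q_i] of [a], only where their weight is zero, so that the product becomes that of
   [a']. *)
have [q [qE qq']] : exists q : 'I_k -> G,
    (forall i, qweights a i != 0 -> q i = (a i).1 true) /\
    \big[mul/e]_(i < k) q i = \big[mul/e]_(i < k) (a' i).1 true.
  have [/eqP/prodf_eq0[j _ /eqP tj]|pN0] := eqVneq (\prod_i qweights a i) 0.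
    have [v hv] := big_mul_adjust mulA mul1g mulVg (fun i => (a i).1 true)
      (\big[mul/e]_(i < k) (a' i).1 true)
      (index_enum_uniq 'I_k) (mem_index_enum j).
    exists (fun i => if i == j then v else (a i).1 true); split=> // i.
    by have [->|//] := eqVneq i j; rewrite tj eqxx.
  exists (fun i => (a i).1 true); split=> //.
  have /= := cc' None; apply; rewrite weight_join_map mulf_neq0 //.
(* [b] represents the same point as [a], but has the [X_i]-coordinates of [a'] and the adjusted
   group coordinates; the action can then carry [b] to [a']. *)
pose b : bases := fun i => (fam2_pair ((a' i).1 false) (q i), (a i).2).
have <- : prod_pi b = prod_pi a.
  apply: functional_extensionality_dep => i; apply/join_piP; split=> //.
  by move=> [] /= w; [exact: qE|exact/esym/xx'].
have [r rE] := act_of_big_mul mulA mul1g mulVg (esym qq').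
apply: quot_pi_sound; exists r, b, a'; split=> //; split=> // i; split.
  by apply: join_base_weight_inj; apply/funext => -[];
    rewrite ?weight_false; [|congr (1 - _)]; exact/esym/tt'.
by split=> //; exact: rE.
Qed.

Lemma orbit_map_surj : (0 < k)%N -> forall y, exists z, orbit_map z = y.
Proof.
move=> k0 y; have [b <-] := quot_pi_surj y.
have [t [t01 tb]] := join_weight_surj (Ordinal k0) (weight_ge0 b) (weight_sum1 b).
(* The whole group coordinate is placed in the first factor; the others carry [e]. *)
have [v hv] := big_mul_adjust mulA mul1g mulVg (fun=> e) (b.1 None)
  (index_enum_uniq 'I_k) (mem_index_enum (Ordinal k0)).
pose a : bases := fun i => (fam2_pair (b.1 (Some i))
    (if i == Ordinal k0 then v else e),
  (SigSub (mem_set (simplex_bool (t01 i))) : simplexT bool)).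
exists (pio (prod_pi a)); rewrite orbit_mapE join_map_quotE.
apply/join_piP; split=> [|[i|] _] //.
by apply: join_base_weight_inj; rewrite weight_join_map -tb.
Qed.

(** * Compactness, separation and the homeomorphism *)

Hypothesis X_compact : forall i, compact [set: X i].
Hypothesis X_hausdorff : forall i, hausdorff_space (X i).
Hypothesis G_compact : compact [set: G].
Hypothesis G_hausdorff : hausdorff_space G.

Lemma bases_compact : compact [set: bases].
Proof.
apply: compact_prod_topology => i; apply: join_base_compact => -[].
  exact: G_compact.
exact: X_compact.
Qed.

Lemma prod_joins_hausdorff : hausdorff_space (prod_joins X G).
Proof.
apply: hausdorff_product => i; apply: join_hausdorff => -[].
  exact: G_hausdorff.
exact: X_hausdorff.
Qed.

(** A product of quotient maps need not be a quotient map; here [prod_pi] goes from a compact space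
    onto a Hausdorff one, so continuity descends along it. *)
Lemma join_map_quot_continuous : continuous join_map_quot.
Proof.
apply: (compact_hausdorff_factor_continuous bases_compact prod_joins_hausdorff
  prod_pi_continuous prod_pi_surj (g := pik \o join_map)).
  by move=> a; apply: continuous_comp; [exact: join_map_continuous
    |exact: quot_pi_continuous].
exact: join_map_quotE.
Qed.

Lemma orbit_map_homeomorphism : (0 < k)%N -> homeomorphism orbit_map.
Proof.
move=> k0; apply: bijective_homeomorphism.
- apply: (compact_image_setT _ (@quot_pi_continuous _ _) (@quot_pi_surj _ _)).
  exact: (compact_image_setT bases_compact prod_pi_continuous prod_pi_surj).
- by apply: join_hausdorff => -[i|]; [exact: X_hausdorff|exact: G_hausdorff].
- apply/quotient_continuous.
  rewrite (_ : _ \o _ = join_map_quot); first exact: join_map_quot_continuous.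
  by apply/funext => p; exact: orbit_mapE.
- exact: orbit_map_inj.
- exact: orbit_map_surj.
Qed.

End OrbitSpace.

Theorem theorem4
  (k : nat) (hk : (2 <= k)%N)
  (X : 'I_k -> topologicalType)
  (X_compact : forall i, compact [set: X i])
  (X_hausdorff : forall i, hausdorff_space (X i))
  (X_nonempty : forall i, [set: X i] !=set0)
  (G : topologicalType) (mul : G -> G -> G) (inv : G -> G) (e : G)
  (mulA : forall x y z, mul x (mul y z) = mul (mul x y) z)
  (mul1g : forall x, mul e x = x)
  (mulVg : forall x, mul (inv x) x = e)
  (mul_cont : continuous (fun p : G * G => mul p.1 p.2))
  (inv_cont : continuous inv)
  (G_compact : compact [set: G])
  (G_hausdorff : hausdorff_space G) :
  exists h : orbit_space X mul inv e -> join (famk X G),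
    homeomorphism h /\
    forall (a : forall i : 'I_k, join_base (fam2 (X i) G))
           (b : join_base (famk X G)),
      let t := fun i : 'I_k => set_val (a i).2 true in
      let A := \prod_(i < k) t i + \sum_(i < k) (1 - t i) in
      (forall i : 'I_k, b.1 (Some i) = (a i).1 false) ->
      b.1 None = \big[mul/e]_(i < k) (a i).1 true ->
      (forall i : 'I_k, set_val b.2 (Some i) = (1 - t i) / A) ->
      set_val b.2 None = (\prod_(i < k) t i) / A ->
      h (\pi_(orbit_space X mul inv e)
           ((fun i => \pi_(join (fam2 (X i) G)) (a i)) : prod_joins X G))%qT
      = (\pi_(join (famk X G)) b)%qT.
Proof.
exists (@orbit_map k X G mul inv e); split.
  by apply: orbit_map_homeomorphism => //; exact: ltnW.
move=> a b t A bS bN wS wN.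
have -> : (fun i => \pi_(join (fam2 (X i) G)) (a i))%qT = prod_pi a by [].
rewrite [LHS](orbit_mapE mulA mul1g mulVg) join_map_quotE.
apply/join_piP; split.
  (* The prescribed weights of [b] are those of [join_map a], as [A] unfolds to [total_weight]. *)
  apply: join_base_weight_inj; rewrite weight_join_map; apply/funext => -[i|].
    by rewrite /weight wS.
  by rewrite /weight wN.
by move=> [i|] _ /=; rewrite ?bS ?bN.
Qed.
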